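(* For any integers $a,b\geq 0$, we have $$t^\star(\{2\}^a,3,\{2\}^b)=\sum_{r=1}^{a+b+1}2^{-2r}\left[(1-2^{-2r})\binom{2r}{2a+1}+\binom{2r}{2b+1}\right]t^\star\bigl(\{2\}^{a+b+1-r}\bigr)\zeta(2r+1).$$
   Context: For positive integers $k_1,\ldots,k_n$ with $k_1>1$, $$t^\star(k_1,\ldots,k_n)=\sum_{m_1\geq\cdots\geq m_n>0,\ m_i\ \mathrm{odd}}\frac{1}{m_1^{k_1}\cdots m_n^{k_n}},$$ and $t^\star(\varnothing)=1$. $\{2\}^n$ denotes $2$ repeated $n$ times (empty if $n=0$). $\zeta$ is the Riemann zeta function, and $\binom{p}{q}=0$ for integers $q>p\geq 0$. *)

(* Defs.v *)
From HB Require Import structures.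
From mathcomp Require Import all_boot all_order all_algebra.
From mathcomp Require Import all_classical all_reals all_analysis.

Set Implicit Arguments.
Unset Strict Implicit.
Unset Printing Implicit Defensive.

Import Order.TTheory GRing.Theory Num.Theory.

Local Open Scope classical_set_scope.
Local Open Scope ring_scope.

(* m_1 >= ... >= m_n > 0 with every m_i odd; positivity follows from oddness. *)
Definition odd_chain (n : nat) : set (n.-tuple nat) :=
  [set m : n.-tuple nat | sorted geq m /\ all odd m].

(* A sum of nonnegative terms, hence taken in [0, +oo]: it is a real number
   for admissible indices (positive, the first one > 1). *)
Definition tstar (R : realType) (k : seq nat) : \bar R :=
  \esum_(m in @odd_chain (size k))
     (\prod_(i < size k) ((tnth m i)%:R ^+ nth 0%N k i)^-1 : R)%:E.

(* Dirichlet series of the Riemann zeta function on s > 1. *)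
Definition zeta (R : realType) (s : R) : \bar R :=
  (\sum_(0 <= n <oo) (riemannR s n)%:E)%E.

Lemma tstar_nil (R : realType) : tstar R [::] = 1%E.
Proof.
rewrite /tstar (_ : @odd_chain 0 = [set [tuple]]).
  by rewrite esum_set1 big_ord0.
by apply/seteqP; split=> [m _|m ->]; [rewrite /= (tuple0 m)|].
Qed.

(* Main.v *)
Require Import Defs.
From HB Require Import structures.
From mathcomp Require Import all_boot all_order all_algebra.
From mathcomp Require Import all_classical all_reals all_analysis.
From mathcomp Require Import ring lra zify.

(**
  The star sum [t*({2}^n)] truncated to odd [m_i <= N] has generating function
  [prod_(m <= N) (1 - x^2/m^2)^-1], whose partial fractions give it as
  [sum_(k <= N) c_(N,k) k^(-2n)].  A telescoping identity for the [c_(N,k)]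
  shows that inserting a 3 gives
  [sum_k c_(N,k) k^(-2a-1) (2 sum_(l < k) l^(-2b-2) + k^(-2b-2))], where k and l
  are odd.  As N grows, [k c_(N,k)] tends to a constant times
  [chi(k) = (-1)^((k-1)/2)], so that [t*({2}^n)] becomes the value at 2n+1 of the
  alternating series [beta(s) = sum_k chi(k) k^(-s)], and the left-hand side the
  double series [sum_k chi(k) k^(-p) sum_(-k <= l < k) l^(-q)] with p = 2a+2 and
  q = 2b+2, both up to the same constant.

  The inner sum is also [sum_(f > 0) ((k-2f)^(-q) - (k+2f)^(-q))].  Expanding
  [k^(-p) (k-2f)^(-q)] and [k^(-p) (k+2f)^(-q)] in partial fractions with respect
  to k, and using [chi(k+2f) = (-1)^f chi(k)], each power of f decouples from a
  sum over k, which is twice a value of [beta] or cancels according to parity;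
  the sums over f of the surviving terms are zeta values at odd integers.
*)

Set Implicit Arguments.
Unset Strict Implicit.
Unset Printing Implicit Defensive.

Import Order.TTheory GRing.Theory Num.Theory.
Import numFieldNormedType.Exports.

Local Open Scope classical_set_scope.
Local Open Scope ring_scope.

(** * Partial fractions of the truncated sums *)

Definition odd_nat {R : realType} (j : nat) : R := (2 * j + 1)%:R.

Lemma odd_natE (R : realType) j : odd_nat j = 2 * j%:R + 1 :> R.
Proof. by rewrite /odd_nat natrD natrM. Qed.

Lemma odd_nat_ge1 (R : realType) j : 1 <= odd_nat j :> R.
Proof. by rewrite /odd_nat ler1n addn1. Qed.

Lemma odd_nat_gt0 (R : realType) j : 0 < odd_nat j :> R.
Proof. exact: lt_le_trans ltr01 (odd_nat_ge1 R j). Qed.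

Lemma odd_nat_neq0 (R : realType) j : odd_nat j != 0 :> R.
Proof. by rewrite gt_eqF ?odd_nat_gt0. Qed.

Lemma inv_odd_nat_ge0 (R : realType) m j : 0 <= (odd_nat j ^+ m)^-1 :> R.
Proof. by rewrite invr_ge0 exprn_ge0// ltW// odd_nat_gt0. Qed.

(** The coefficient at the pole x = 1: the product of (1 - 1/m^2)^-1 over the odd m from 3 to
    2n+1. *)
Definition pfconst {R : realType} (n : nat) : R :=
  \prod_(i < n) (odd_nat i.+1 ^+ 2 / (odd_nat i.+1 ^+ 2 - 1)).

(** For j <= n this is C(2n+1, n-j) / C(2n+1, n). In product form it vanishes for j > n and, for
    fixed j, tends to 1 factor by factor. *)
Definition pfratio {R : realType} (n j : nat) : R :=
  \prod_(i < j) ((n%:R - i%:R) / (n%:R + 2 + i%:R)).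

Lemma pfratio_recr (R : realType) n j :
  pfratio n j.+1 = pfratio n j * ((n%:R - j%:R) / (n%:R + 2 + j%:R)) :> R.
Proof. by rewrite /pfratio big_ord_recr. Qed.

(* [pfweight n j / k], with k = 2j+1, is the coefficient of 1 / (1 - x^2/k^2)
   in the partial fraction expansion of
   1 / ((1 - x^2/1^2) (1 - x^2/3^2) ... (1 - x^2/(2n+1)^2));
   it vanishes for n < j. *)
Definition pfweight {R : realType} (n j : nat) : R :=
  pfconst n * (-1) ^+ j * pfratio n j.

(** With k = 2j+1 and N = 2n+1, the new factor of [pfratio] is (N - k)/(N + k + 2). This recurrence
    drives both telescopings, [pfsum_cube] and [pfsum_inv]. *)
Lemma pfweight_recr (R : realType) n j :
  (odd_nat j.+1 + odd_nat n) * pfweight n j.+1 =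
  (odd_nat j - odd_nat n) * pfweight n j :> R.
Proof.
rewrite /pfweight pfratio_recr exprS !odd_natE -natr1.
have n0 : 0 <= n%:R :> R by []. have j0 : 0 <= j%:R :> R by [].
by field; apply/eqP; lra.
Qed.

Lemma pfratio_eq0 (R : realType) n j : (n < j)%N -> pfratio n j = 0 :> R.
Proof. by move=> nj; rewrite /pfratio (bigD1 (Ordinal nj))//= subrr !mul0r. Qed.

Lemma pfweight_eq0 (R : realType) n j : (n < j)%N -> pfweight n j = 0 :> R.
Proof. by move=> nj; rewrite /pfweight pfratio_eq0 ?mulr0. Qed.

Lemma pfratioSn (R : realType) n j :
  (n%:R + 1) * (n%:R + 2) * pfratio n j =
  (n%:R + 1 - j%:R) * (n%:R + 2 + j%:R) * pfratio n.+1 j :> R.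
Proof.
elim: j => [|j IH]; first by rewrite /pfratio !big_ord0; ring.
rewrite !pfratio_recr mulrA IH -!natr1.
have n0 : 0 <= n%:R :> R by []. have j0 : 0 <= j%:R :> R by [].
field; apply/andP; split; apply/eqP; lra.
Qed.

(** Going from n+1 down to n multiplies the generating product by 1 - x^2/(2n+3)^2; its value at the
    pole x = k is the ratio of the coefficients. *)
Lemma pfweightSn (R : realType) n j :
  pfweight n j =
  (1 - odd_nat j ^+ 2 / odd_nat n.+1 ^+ 2) * pfweight n.+1 j :> R.
Proof.
have n0 : 0 <= n%:R :> R by []. have j0 : 0 <= j%:R :> R by [].
have H := pfratioSn R n j.
rewrite {1}/pfweight.
have -> : pfratio n j = (n%:R + 1 - j%:R) * (n%:R + 2 + j%:R) * pfratio n.+1 j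
    / ((n%:R + 1) * (n%:R + 2)) :> R.
  by rewrite -H mulrC mulKf// gt_eqF// mulr_gt0//; lra.
rewrite /pfweight [pfconst n.+1]big_ord_recr /= -/(pfconst n) !odd_natE -!natr1.
field.
have n1 : (2 * (n%:R + 1) + 1) != 0 :> R by apply/eqP; lra.
rewrite n1 /=; apply/and3P; split; apply/eqP; try lra.
rewrite (_ : _ - 1 = 4 * (n%:R + 1) * (n%:R + 2) :> R); last by ring.
by apply/eqP; rewrite gt_eqF// !mulr_gt0//; lra.
Qed.

Definition pfsum {R : realType} (n : nat) (phi : nat -> R) : R :=
  \sum_(j < n.+1) pfweight n j * phi j.

Lemma pfsumSn (R : realType) n (phi : nat -> R) :
  pfsum n.+1 phi - pfsum n phi =
  pfsum n.+1 (fun j => odd_nat j ^+ 2 * phi j) / odd_nat n.+1 ^+ 2.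
Proof.
have -> : pfsum n phi = \sum_(j < n.+2) pfweight n j * phi j.
  by rewrite [RHS]big_ord_recr /= pfweight_eq0 // mul0r addr0.
rewrite -sumrB mulr_suml; apply: eq_bigr => j _.
rewrite [pfweight n j]pfweightSn.
by move: (odd_nat n.+1) (odd_nat_neq0 R n.+1) => o o0; field.
Qed.

(** Prepending a 2 to an index divides [phi] by k^2: by [pfsumSn], both sides have the same
    increments in n. *)
Lemma sum_pfsum_sqr (R : realType) n (phi : nat -> R) :
  \sum_(m < n.+1) pfsum m phi / odd_nat m ^+ 2 =
  pfsum n (fun j => phi j / odd_nat j ^+ 2).
Proof.
elim: n => [|n IH].
  by rewrite big_ord1 /pfsum !big_ord1; rewrite mulrA.
rewrite big_ord_recr /= IH; apply/eqP; rewrite addrC eq_sym -subr_eq pfsumSn.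
apply/eqP; congr (_ / _); apply: eq_bigr => j _; congr (_ * _).
by rewrite mulrC divfK// expf_neq0 ?odd_nat_neq0.
Qed.

(** Summation by parts. With N = 2n+1 and B_j = (odd_nat j + N) w_j, where w_j is the weight,
    [pfweight_recr] says B_j - B_(j+1) = 2N w_j; the boundary term at J = n+1 vanishes. *)
Lemma pfsum_cube (R : realType) n (psi : nat -> R) :
  odd_nat n * pfsum n (fun j => 2 * (\sum_(i < j) psi i) + psi j) =
  pfsum n (fun j => odd_nat j * psi j).
Proof.
suff H J : \sum_(j < J) (2 * odd_nat n * pfweight n j * \sum_(i < j) psi i) =
   \sum_(j < J) (odd_nat j - odd_nat n) * pfweight n j * psi j
   - (odd_nat J + odd_nat n) * pfweight n J * \sum_(i < J) psi i.
  move: (H n.+1); rewrite pfweight_eq0// mulr0 mul0r subr0 /pfsum => {}H.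
  apply/eqP; rewrite -subr_eq0; apply/eqP.
  rewrite mulr_sumr -sumrB.
  transitivity (\sum_(j < n.+1) (2 * odd_nat n * pfweight n j * (\sum_(i < j) psi i))
     - \sum_(j < n.+1) (odd_nat j - odd_nat n) * pfweight n j * psi j).
    by rewrite -sumrB; apply: eq_bigr => j _; ring.
  by rewrite H subrr.
elim: J => [|J IH]; first by rewrite !big_ord0 mulr0 subr0.
rewrite big_ord_recr /= IH [in RHS]big_ord_recr /= pfweight_recr.
by rewrite [\sum_(i < J.+1) psi i]big_ord_recr /=; ring.
Qed.

(** Prepending a 3: one of the three factors 1/m is traded for an inner sum by [pfsum_cube], and the
    remaining 1/m^2 falls to [sum_pfsum_sqr]. *)
Lemma sum_pfsum_cube (R : realType) n (psi : nat -> R) :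
  \sum_(m < n.+1) pfsum m (fun j => odd_nat j * psi j) / odd_nat m ^+ 3 =
  pfsum n (fun j => (2 * (\sum_(i < j) psi i) + psi j) / odd_nat j ^+ 2).
Proof.
rewrite -sum_pfsum_sqr; apply: eq_bigr => m _.
rewrite -pfsum_cube.
by move: (odd_nat m) (odd_nat_neq0 R m) => o o0; field.
Qed.

(** This is the generating product at x = 0. *)
Lemma pfsum_inv (R : realType) n : pfsum n (fun j => (odd_nat j)^-1) = 1 :> R.
Proof.
elim: n => [|n IH].
  by rewrite /pfsum big_ord1 /pfweight /pfconst /pfratio !big_ord0 /odd_nat invr1 !mulr1.
apply/eqP; rewrite -subr_eq0 -IH pfsumSn mulf_eq0; apply/orP; left.
rewrite /pfsum.
(* The increment in n is a multiple of the sum of k w_j. Its partial sums telescope to a multiple of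
   the weight at J, which is 0 at J = n+2. *)
suff H J : 2 * (1 - odd_nat n.+1) * \sum_(j < J) (odd_nat j * pfweight n.+1 j) =
   2 * J%:R * (odd_nat J + odd_nat n.+1) * pfweight n.+1 J :> R.
  move: (H n.+2); rewrite pfweight_eq0// mulr0 => /eqP; rewrite mulf_eq0 => /orP[|/eqP E].
    by rewrite odd_natE -natr1; move: (ler0n R n) => ? /eqP ?; exfalso; lra.
  apply/eqP; rewrite -[RHS]E; apply: eq_bigr => j _.
  by move: (odd_nat j) (odd_nat_neq0 R j) => o o0; field.
elim: J => [|J IHJ]; first by rewrite !big_ord0 !mulr0 !mul0r.
rewrite big_ord_recr /= mulrDr IHJ -[in RHS]mulrA pfweight_recr -natr1 !odd_natE; ring.
Qed.

(* The truncation of t* to m_1 <= 2n+1. *)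
Fixpoint tpart {R : realType} (ks : seq nat) (n : nat) : R :=
  if ks is k :: ks' then \sum_(j < n.+1) (odd_nat j ^+ k)^-1 * tpart ks' j else 1.

Lemma tpart_nseq_cat (R : realType) a ks (phi : nat -> R) :
  (forall n, tpart ks n = pfsum n phi) ->
  forall n, tpart (nseq a 2%N ++ ks) n = pfsum n (fun j => phi j / odd_nat j ^+ (2 * a)).
Proof.
move=> H; elim: a => [|a IH] n /=.
  by rewrite H; apply: eq_bigr => j _; rewrite muln0 expr0 divr1.
transitivity (\sum_(m < n.+1) pfsum m (fun j => phi j / odd_nat j ^+ (2 * a)) / odd_nat m ^+ 2 : R).
  by apply: eq_bigr => m _; rewrite IH mulrC.
rewrite sum_pfsum_sqr; apply: eq_bigr => j _.
by congr (_ * _); rewrite -mulrA -invfM -exprD; congr (_ / _ ^+ _); lia.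
Qed.

Lemma tpart_nseq2 (R : realType) a n :
  tpart (nseq a 2%N) n = pfsum n (fun j => (odd_nat j ^+ (2 * a + 1))^-1) :> R.
Proof.
rewrite -[nseq _ _]cats0 (@tpart_nseq_cat _ _ _ (fun j => (odd_nat j)^-1)).
  apply: eq_bigr => j _; rewrite -invfM; congr (_ * _^-1).
  by rewrite addn1 exprS.
by move=> m; rewrite pfsum_inv.
Qed.

Lemma tpart_nseq232 (R : realType) a b n :
  tpart (nseq a 2%N ++ 3%N :: nseq b 2%N) n =
  pfsum n (fun j => (2 * (\sum_(i < j) (odd_nat i ^+ (2 * b + 2))^-1)
                     + (odd_nat j ^+ (2 * b + 2))^-1)
                    / odd_nat j ^+ (2 * a + 2)) :> R.
Proof.
rewrite (@tpart_nseq_cat _ _ _ (fun j => (2 * (\sum_(i < j) (odd_nat i ^+ (2 * b + 2))^-1)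
                     + (odd_nat j ^+ (2 * b + 2))^-1) / odd_nat j ^+ 2)).
  apply: eq_bigr => j _; congr (_ * _); rewrite -mulrA -invfM -exprD.
  by congr (_ / _ ^+ _); lia.
move=> {}n; rewrite -sum_pfsum_cube /=; apply: eq_bigr => m _.
rewrite tpart_nseq2 mulrC; congr (_ / _); apply: eq_bigr => j _.
(* The 2s after the 3 give k^(-2b-1), to be read as k times psi with psi = k^(-2b-2). *)
congr (_ * _); have -> : (2 * b + 2 = (2 * b + 1).+1)%N by lia.
by rewrite [in RHS]exprS invfM mulVKf ?odd_nat_neq0.
Qed.

(** * The star sums as limits of their truncations *)

(** The chains that may follow an entry N, hence the tails left when the head of a chain is
    removed. *)
Definition bounded_odd_chain (N n : nat) : set (n.-tuple nat) :=
  [set m : n.-tuple nat | path geq N m /\ all odd m].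

Lemma odd_uphalf (y : nat) : odd y -> (2 * y./2 + 1 = y)%N.
Proof. by move=> oy; rewrite -[RHS]odd_double_half oy -mul2n addnC. Qed.

(** Splits a chain into its head 2j+1 and its tail. [Q] is the set of allowed j: all of them for
    unbounded chains, those up to n for chains bounded by 2n+1. *)
Lemma esum_odd_chain_recl (R : realType) n (Q : set nat) (S : set (n.+1.-tuple nat))
    (a : n.+1.-tuple nat -> \bar R) :
  (forall j (t : n.-tuple nat), S [tuple of (2 * j + 1)%N :: t] <->
     Q j /\ bounded_odd_chain (2 * j + 1) t) ->
  (forall m, S m -> odd (thead m)) ->
  (forall m, (0 <= a m)%E) ->
  \esum_(m in S) a m =
  \esum_(j in Q) \esum_(t in @bounded_odd_chain (2 * j + 1) n)
     a [tuple of (2 * j + 1)%N :: t].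
Proof.
move=> SQ So a0; rewrite esum_esum//.
rewrite (reindex_esum (Q `*`` fun j => @bounded_odd_chain (2 * j + 1) n) S
  (fun x => [tuple of (2 * x.1 + 1)%N :: x.2]))//; split.
- by move=> [j t] /= H; apply/SQ.
- move=> [j t] [j' t'] /= _ _ /(congr1 val)/= [jj tt].
  by congr pair; [lia|exact: val_inj].
- move=> m Sm; have om := So _ Sm.
  exists ((thead m)./2, [tuple of behead m]).
    by apply/SQ; rewrite odd_uphalf//; move: Sm; rewrite {1}(tuple_eta m).
  by rewrite [RHS]tuple_eta; apply: val_inj => /=; rewrite odd_uphalf.
Qed.

Lemma tpart_ge0 (R : realType) ks n : 0 <= tpart ks n :> R.
Proof.
elim: ks n => [|k ks IH] n //=; apply: sumr_ge0 => j _.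
by rewrite mulr_ge0// inv_odd_nat_ge0.
Qed.

(** The factor [c] collects the entries already removed, which lets the induction on [ks] run inside
    the summand. *)
Lemma esum_bounded_odd_chain (R : realType) (ks : seq nat) (c : R) n :
  0 <= c ->
  \esum_(m in @bounded_odd_chain (2 * n + 1) (size ks))
     (c * \prod_(i < size ks) ((tnth m i)%:R ^+ nth 0%N ks i)^-1)%:E
  = (c * tpart ks n)%:E.
Proof.
elim: ks c n => [|k ks IH] c n c0.
  rewrite (_ : @bounded_odd_chain _ 0 = [set [tuple]]).
    by rewrite esum_set1 big_ord0 /= ?mulr1.
  by apply/seteqP; split=> [m _|m ->]; [rewrite /= (tuple0 m)|].
rewrite (@esum_odd_chain_recl _ (size ks) `I_n.+1).
- rewrite esum_fset//; last first.
    by move=> j _; apply: esum_ge0 => t _; rewrite lee_fin mulr_ge0// prodr_ge0.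
  rewrite -fsbig_ord /= mulr_sumr -sumEFin; apply: eq_bigr => j _.
  rewrite mulrA -IH; last by rewrite mulr_ge0// inv_odd_nat_ge0.
  apply: eq_esum => t _; rewrite big_ord_recl /= -mulrA; congr (_ * (_ * _))%:E.
  by apply: eq_bigr => i _; rewrite tnthS.
- move=> j t; rewrite /bounded_odd_chain /= addn1 /= oddM /=; split.
    by move=> [/andP[h1 h2] h3]; split=> //; move: h1; rewrite /geq /=; lia.
  by move=> [h1 [h2 h3]]; split=> //; rewrite h2 andbT /geq /=; lia.
- by move=> m; rewrite /bounded_odd_chain /= (tuple_eta m) /= theadE => -[_ /andP[]].
- by move=> m; rewrite lee_fin mulr_ge0// prodr_ge0.
Qed.

Lemma tstar_cons (R : realType) k ks :
  tstar R (k :: ks) = (\sum_(0 <= j <oo) ((odd_nat j ^+ k)^-1 * tpart ks j)%:E)%E.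
Proof.
rewrite nneseries_esumT; last first.
  by move=> j; rewrite lee_fin mulr_ge0 ?tpart_ge0// inv_odd_nat_ge0.
rewrite /tstar (@esum_odd_chain_recl _ (size ks) setT).
- apply: eq_esum => j _; rewrite -esum_bounded_odd_chain ?inv_odd_nat_ge0//.
  apply: eq_esum => t _; rewrite big_ord_recl /=; congr (_ * _)%:E.
  by apply: eq_bigr => i _; rewrite tnthS.
- move=> j t; rewrite /bounded_odd_chain /odd_chain /= addn1 /= oddM /=.
  by split=> [[]|[_ []]].
- by move=> m; rewrite /odd_chain /= (tuple_eta m) /= theadE => -[_ /andP[]].
- by move=> m; rewrite lee_fin prodr_ge0.
Qed.

Lemma tstar_lim (R : realType) ks (t : R) :
  tpart ks n @[n --> \oo] --> t -> tstar R ks = t%:E.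
Proof.
case: ks => [|k ks] cvt.
  by rewrite tstar_nil; congr EFin; apply: cvg_unique cvt => //; exact: cvg_cst.
rewrite tstar_cons; apply/cvg_lim => //.
(* [tpart] at n includes j = n, so it has n+1 terms. *)
rewrite -(cvg_shiftn 1).
have -> : (fun n => (\sum_(0 <= k0 < n + 1) ((odd_nat k0 ^+ k)^-1 * tpart ks k0)%:E)%E)
   = (fun n => (tpart (k :: ks) n)%:E) :> (nat -> \bar R).
  by apply/funext => n; rewrite sumEFin addn1 big_mkord.
by apply: cvg_EFin; [exact: nearW|exact: cvt].
Qed.

(** * Passage to the limit in the partial fractions *)

Lemma cvgn_le (R : realType) (u : nat -> R) (l e : R) :
  u n @[n --> \oo] --> l -> (\forall n \near \oo, u n <= e) -> l <= e.
Proof.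
move=> ul ue; rewrite -(cvg_lim _ ul)//.
by apply: limr_le => //; apply/cvg_ex; exists l.
Qed.

Lemma cvg_invS (R : realType) (C : R) : (C / n.+1%:R) @[n --> \oo] --> (0 : R).
Proof.
rewrite -(mulr0 C); apply: cvgMr; exact: (@cvg_harmonic R).
Qed.

Lemma squeeze_invS (R : realType) (u : nat -> R) (l C : R) :
  (forall n, `|l - u n| <= C / n.+1%:R) -> u n @[n --> \oo] --> l.
Proof.
move=> H; have H0 : (l - u n) @[n --> \oo] --> (0 : R).
  apply/norm_cvg0P; apply: (@squeeze_cvgr _ _ _ _ (fun=> 0) (fun n => C / n.+1%:R)).
  - by apply: nearW => n; rewrite normr_ge0 H.
  - exact: cvg_cst.
  - exact: cvg_invS.
have -> : u = (fun n => l - (l - u n)) by apply/funext => n; rewrite subKr.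
by rewrite -[X in _ --> X]subr0; apply: cvgB => //; exact: cvg_cst.
Qed.

(** Leibniz's criterion: removing the first term leaves v M minus a sum of the same kind started at
    M+1. *)
Lemma alternating_sum_itv (R : realType) (v : nat -> R) M d :
  (forall j, 0 <= v j) -> (forall j, v j.+1 <= v j) ->
  0 <= \sum_(i < d) (-1) ^+ i * v (M + i)%N <= v M.
Proof.
move=> v0 v1; elim: d M => [|d IH] M; first by rewrite big_ord0 lexx v0.
rewrite big_ord_recl expr0 mul1r addn0.
rewrite (eq_bigr (fun i : 'I_d => - ((-1) ^+ i * v (M.+1 + i)%N))); last first.
  by move=> i _; rewrite lift0 exprS mulN1r mulNr addnS addSn.
rewrite sumrN; have /andP[h1 h2] := IH M.+1.
by rewrite subr_ge0 (le_trans h2)//= gerBl.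
Qed.

Lemma alternating_sum_le (R : realType) (v : nat -> R) M N :
  (forall j, 0 <= v j) -> (forall j, v j.+1 <= v j) ->
  `|\sum_(M <= j < N) (-1) ^+ j * v j| <= v M.
Proof.
move=> v0 v1; have [NM|MN] := leqP N M; first by rewrite big_geq ?normr0.
rewrite -[X in \sum_(X <= _ < _) _]add0n big_addn big_mkord.
rewrite (eq_bigr (fun i : 'I_(N - M) => (-1) ^+ M * ((-1) ^+ i * v (M + i)%N))); last first.
  by move=> i _; rewrite exprD mulrA addnC [(-1) ^+ i * _]mulrC.
have /andP[h1 h2] := alternating_sum_itv M (N - M) v0 v1.
by rewrite -mulr_sumr normrM normrX normrN1 expr1n mul1r ger0_norm.
Qed.

Lemma odd_nat_le (R : realType) i j : (i <= j)%N -> odd_nat i <= odd_nat j :> R.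
Proof. by rewrite /odd_nat ler_nat; lia. Qed.

Lemma ge1_expr_inv_le (R : realType) (x : R) m n :
  1 <= x -> (m <= n)%N -> (x ^+ n)^-1 <= (x ^+ m)^-1.
Proof.
move=> x1 mn; have x0 : 0 < x by apply: lt_le_trans x1.
by rewrite lef_pV2 ?posrE ?exprn_gt0// ler_weXn2l.
Qed.

Lemma inv_odd_nat_le (R : realType) m i j : (i <= j)%N ->
  (odd_nat j ^+ m)^-1 <= (odd_nat i ^+ m)^-1 :> R.
Proof.
move=> ij; rewrite lef_pV2 ?posrE ?exprn_gt0 ?odd_nat_gt0//.
by rewrite lerXn2r ?nnegrE ?(ltW (odd_nat_gt0 _ _)) ?odd_nat_le.
Qed.

Lemma sum_inv_odd_sqr (R : realType) M N :
  \sum_(M <= j < N) (odd_nat j ^+ 2)^-1 <= 2 / M.+1%:R :> R.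
Proof.
have [NM|MN] := leqP N M; first by rewrite big_geq// divr_ge0.
(* Subtracting 1/(N+1) makes the bound inductive, as a term with N >= 1 is at most 1/(N+1) -
   1/(N+2). The numerator 2 makes room for the first term. *)
suff : \sum_(M <= j < N) (odd_nat j ^+ 2)^-1 <= 2 / M.+1%:R - (N.+1%:R)^-1 :> R.
  by move/le_trans; apply; rewrite gerBl invr_ge0.
elim: N MN => // N IH; rewrite ltnS leq_eqVlt => /predU1P[<-|MN].
  rewrite big_nat1 odd_natE -(natr1 M.+1) -(natr1 M); have : 0 <= M%:R :> R by [].
  move: (M%:R) => x x0; rewrite -subr_ge0.
  have -> : 2 / (x + 1) - (x + 1 + 1)^-1 - ((2 * x + 1) ^+ 2)^-1 =
    (4 * x ^+ 3 + 15 * x ^+ 2 + 10 * x + 1) / ((x + 1) * (x + 1 + 1) * (2 * x + 1) ^+ 2).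
    by field; apply/and3P; split; apply/eqP; lra.
  by rewrite divr_ge0// ?mulr_ge0 ?exprn_ge0// ?addr_ge0// ?mulr_ge0 ?exprn_ge0//; lra.
rewrite big_nat_recr 1?ltnW//=; move: (IH MN).
suff : (odd_nat N ^+ 2)^-1 <= (N.+1%:R)^-1 - (N.+2%:R)^-1 :> R.
  by move=> h1 h2; rewrite (le_trans (lerD h2 h1))// addrA subrK.
have N1 : 1 <= N%:R :> R by rewrite ler1n; lia.
rewrite odd_natE -(natr1 N.+1) -(natr1 N); move: (N%:R) N1 => x x1; rewrite -subr_ge0.
have -> : (x + 1)^-1 - (x + 1 + 1)^-1 - ((2 * x + 1) ^+ 2)^-1 =
    (3 * x ^+ 2 + x - 1) / ((x + 1) * (x + 1 + 1) * (2 * x + 1) ^+ 2).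
  by field; apply/and3P; split; apply/eqP; lra.
by rewrite divr_ge0// ?mulr_ge0 ?exprn_ge0//; nra.
Qed.

Lemma pfconst_ge1 (R : realType) n : 1 <= pfconst n :> R.
Proof.
elim: n => [|n IH]; first by rewrite /pfconst big_ord0.
rewrite /pfconst big_ord_recr /= -/(pfconst n) mulr_ege1//.
have : 3 <= odd_nat n.+1 :> R by rewrite /odd_nat ler_nat; lia.
by move=> h; rewrite ler_pdivlMr; nra.
Qed.

Lemma pfconst_homo (R : realType) : nondecreasing_seq (@pfconst R).
Proof.
apply/nondecreasing_seqP => n.
rewrite /pfconst big_ord_recr /= -/(pfconst n).
have : 3 <= odd_nat n.+1 :> R by rewrite /odd_nat ler_nat; lia.
have := pfconst_ge1 R n.
move=> h1 h; rewrite ler_peMr//; first by lra.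
by rewrite ler_pdivlMr; nra.
Qed.

Lemma pfconst_le2 (R : realType) n : pfconst n <= 2 :> R.
Proof.
(* An inductive bound must grow with n; (2n+1)/(n+1) increases to 2. *)
suff H : pfconst n <= odd_nat n / n.+1%:R :> R.
  apply: (le_trans H); rewrite ler_pdivrMr// odd_natE -(natr1 n); lra.
elim: n => [|n IH]; first by rewrite /pfconst big_ord0 /odd_nat divr1.
rewrite /pfconst big_ord_recr /= -/(pfconst n).
have n0 : 0 <= n%:R :> R by [].
have p0 : 0 <= odd_nat n.+1 ^+ 2 / (odd_nat n.+1 ^+ 2 - 1) :> R.
  have : 3 <= odd_nat n.+1 :> R by rewrite /odd_nat ler_nat; lia.
  by move=> h; rewrite divr_ge0//; nra.
apply: le_trans (ler_wpM2r p0 IH) _.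
rewrite !odd_natE -(natr1 n.+1) -(natr1 n); move: (n%:R) n0 => x x0; rewrite -subr_ge0.
have q0 : (2 * (x + 1) + 1) ^+ 2 - 1 != 0 :> R by apply/eqP; nra.
have -> : (2 * (x + 1) + 1) / (x + 1 + 1) - (2 * x + 1) / (x + 1) *
   ((2 * (x + 1) + 1) ^+ 2 / ((2 * (x + 1) + 1) ^+ 2 - 1)) =
   (2 * x + 3) / (4 * (x + 2) * (x + 1) ^+ 2).
  by field; rewrite q0 andbT; apply/andP; split; apply/eqP; lra.
by rewrite divr_ge0// ?mulr_ge0 ?exprn_ge0//; lra.
Qed.

Lemma pfratio_ge0 (R : realType) n j : 0 <= pfratio n j :> R.
Proof.
have [nj|jn] := ltnP n j; first by rewrite pfratio_eq0.
apply: prodr_ge0 => i _; apply: divr_ge0; last by rewrite !addr_ge0.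
by rewrite subr_ge0 ler_nat (leq_trans _ jn)// ltnW.
Qed.

Lemma pfratioS_le (R : realType) n j : pfratio n j.+1 <= pfratio n j :> R.
Proof.
rewrite pfratio_recr ler_piMr ?pfratio_ge0//.
have j0 : 0 <= j%:R :> R by []. have n0 : 0 <= n%:R :> R by [].
by rewrite ler_pdivrMr; lra.
Qed.

Lemma pfratio_le1 (R : realType) n j : pfratio n j <= 1 :> R.
Proof.
elim: j => [|j IH]; first by rewrite /pfratio big_ord0.
exact: le_trans (pfratioS_le _ _ _) IH.
Qed.

Lemma cvg_pfratio (R : realType) j : pfratio n j @[n --> \oo] --> (1 : R).
Proof.
elim: j => [|j IH].
  rewrite (_ : (fun n => pfratio n 0) = cst (1 : R)); first exact: cvg_cst.
  by apply/funext => n; rewrite /pfratio big_ord0.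
rewrite -[X in _ --> X]mulr1.
rewrite (_ : (fun n => pfratio n j.+1) =
  (fun n => pfratio n j * ((n%:R - j%:R) / (n%:R + 2 + j%:R)) : R)).
  apply: cvgM => //; apply: (@squeeze_invS _ _ _ (2 * j%:R + 2)) => n.
  have n0 : 0 <= n%:R :> R by []. have j0 : 0 <= j%:R :> R by [].
  have -> : 1 - (n%:R - j%:R) / (n%:R + 2 + j%:R) = (2 * j%:R + 2) / (n%:R + 2 + j%:R) :> R.
    by field; apply/eqP; lra.
  rewrite ger0_norm; last by rewrite divr_ge0//; lra.
  by rewrite ler_wpM2l// lef_pV2 ?posrE -?(natr1 n)//; lra.
by apply/funext => n; rewrite pfratio_recr.
Qed.

(* Its value is 4/pi (Wallis). *)
Definition pflim (R : realType) : R := limn (@pfconst R).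

Lemma cvg_pfconst (R : realType) : pfconst n @[n --> \oo] --> pflim R.
Proof.
apply: nondecreasing_is_cvgn; first exact: pfconst_homo.
by exists 2 => _ [n _ <-]; exact: pfconst_le2.
Qed.

Lemma pflim_ge1 (R : realType) : 1 <= pflim R.
Proof.
apply: limr_ge; first exact: cvg_pfconst.
by apply: nearW => n; exact: pfconst_ge1.
Qed.

Lemma cvg_pfweight (R : realType) j :
  pfweight n j @[n --> \oo] --> pflim R * (-1) ^+ j.
Proof.
rewrite -[X in _ --> X]mulr1; apply: cvgM; last exact: cvg_pfratio.
by apply: cvgMl; exact: cvg_pfconst.
Qed.

(** Interchanges the limit in n with the sum over j: the first M terms converge one by one, and the
    tails are bounded uniformly in n. Such a tail bound is available even for phi = 1/k, where the
    limit series converges only conditionally. *)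
Lemma pfsum_truncation (R : realType) (phi : nat -> R) (t e : R) M :
  pfsum n phi @[n --> \oo] --> t ->
  (forall n, `|\sum_(M <= j < n.+1) pfweight n j * phi j| <= e) ->
  `|t - pflim R * \sum_(j < M) (-1) ^+ j * phi j| <= e.
Proof.
move=> cvt H.
apply: (@cvgn_le _ (fun n => `|pfsum n phi - \sum_(j < M) pfweight n j * phi j|)).
  apply: cvg_norm; apply: cvgB => //.
  rewrite mulr_sumr; apply: cvg_big => [|j _]; first exact: add_continuous.
  by rewrite mulrA; apply: cvgMl; exact: cvg_pfweight.
exists M => // n /= Mn; rewrite /pfsum -!(big_mkord xpredT (fun j => pfweight n j * phi j)).
by rewrite (big_cat_nat (n := M))//= ?(leqW Mn)// addrAC subrr add0r H.
Qed.

Lemma normr_pfweight (R : realType) n j : `|pfweight n j| <= 2 :> R.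
Proof.
rewrite /pfweight !normrM normrX normrN1 expr1n mulr1.
rewrite ger0_norm; last by rewrite (le_trans ler01) ?pfconst_ge1.
rewrite ger0_norm ?pfratio_ge0// -[leRHS]mulr1.
by rewrite ler_pM ?pfratio_ge0 ?pfratio_le1 ?pfconst_le2// (le_trans ler01) ?pfconst_ge1.
Qed.

(** For fixed n the terms alternate and decrease in absolute value, so the first one bounds the
    tail. *)
Lemma pfsum_inv_tail (R : realType) i M n :
  `|\sum_(M <= j < n.+1) pfweight n j * (odd_nat j ^+ i.+1)^-1| <= 2 / M.+1%:R :> R.
Proof.
have k0 : 0 <= pfconst n :> R by rewrite (le_trans ler01) ?pfconst_ge1.
pose v j : R := pfconst n * (pfratio n j * (odd_nat j ^+ i.+1)^-1).
have v0 j : 0 <= v j by rewrite mulr_ge0// mulr_ge0 ?pfratio_ge0 ?inv_odd_nat_ge0.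
have v1 j : v j.+1 <= v j.
  apply: ler_wpM2l => //.
  by rewrite ler_pM ?pfratio_ge0 ?inv_odd_nat_ge0 ?pfratioS_le ?inv_odd_nat_le.
rewrite (eq_bigr (fun j => (-1) ^+ j * v j)); last first.
  by move=> j _; rewrite /v /pfweight; ring.
apply: le_trans (alternating_sum_le M n.+1 v0 v1) _.
rewrite /v ler_pM ?pfconst_le2 ?mulr_ge0 ?pfratio_ge0 ?inv_odd_nat_ge0//.
rewrite -[leRHS]mul1r ler_pM ?pfratio_ge0 ?inv_odd_nat_ge0 ?pfratio_le1//.
apply: le_trans (@ge1_expr_inv_le _ _ 1 _ _ _) _ => //; first exact: odd_nat_ge1.
by rewrite expr1 lef_pV2 ?posrE ?odd_nat_gt0// /odd_nat ler_nat; lia.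
Qed.

(** For even q, the sum of l^(-q) over the odd integers l with -k <= l < k, where k = 2j+1. *)
Definition oddharm {R : realType} (q j : nat) : R :=
  2 * (\sum_(i < j) (odd_nat i ^+ q)^-1) + (odd_nat j ^+ q)^-1.

Lemma oddharm_itv (R : realType) q j : 0 <= (oddharm q.+2 j : R) <= 5.
Proof.
have s0 : 0 <= \sum_(i < j) (odd_nat i ^+ q.+2)^-1 :> R.
  by apply: sumr_ge0 => i _; exact: inv_odd_nat_ge0.
have s2 : \sum_(i < j) (odd_nat i ^+ q.+2)^-1 <= 2 :> R.
  apply: le_trans (_ : \sum_(0 <= i < j) (odd_nat i ^+ 2)^-1 <= _).
    by rewrite big_mkord ler_sum// => i _; exact: (ge1_expr_inv_le (odd_nat_ge1 _ _)).
  by apply: le_trans (sum_inv_odd_sqr _ _ _) _; rewrite divr1.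
have : (odd_nat j ^+ q.+2)^-1 <= 1 :> R.
  apply: le_trans (@ge1_expr_inv_le _ _ 0 _ (odd_nat_ge1 _ _) _) _ => //.
  by rewrite expr0 invr1.
rewrite /oddharm; have := inv_odd_nat_ge0 R q.+2 j => h1 h2.
by apply/andP; split; lra.
Qed.

(** Here absolute values suffice: 20 = 2 * 5 * 2, from the bounds on the weight, on [oddharm] and on
    the tail of the sum of k^(-2). *)
Lemma pfsum_oddharm_tail (R : realType) p q M n :
  `|\sum_(M <= j < n.+1) pfweight n j * (oddharm q.+2 j / odd_nat j ^+ p.+2)|
  <= 20 / M.+1%:R :> R.
Proof.
apply: le_trans (_ : \sum_(M <= j < n.+1) 10 * (odd_nat j ^+ 2)^-1 <= _).
  apply: le_trans (ler_norm_sum _ _ _) _; apply: ler_sum => j _.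
  rewrite normrM [`|oddharm _ _ / _|]normrM normfV (_ : 10 = 2 * 5); last by ring.
  have /andP[h0 h5] := oddharm_itv R q j.
  rewrite -mulrA ler_pM ?normr_pfweight//.
  rewrite ler_pM//; first by rewrite ger0_norm.
  rewrite ger0_norm ?exprn_ge0 ?(ltW (odd_nat_gt0 _ _))//.
  exact: (ge1_expr_inv_le (odd_nat_ge1 _ _)).
rewrite -mulr_sumr (_ : 20 = 10 * 2); last by ring.
by rewrite -mulrA ler_wpM2l ?sum_inv_odd_sqr.
Qed.

Lemma cvg_tpart (R : realType) ks (C : R) : (forall n, tpart ks n <= C) ->
  exists t : R, tpart ks n @[n --> \oo] --> t.
Proof.
move=> H; exists (limn (@tpart R ks)); apply: nondecreasing_is_cvgn.
  apply/nondecreasing_seqP => n; case: {H} ks => //= k ks.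
  by rewrite [leRHS]big_ord_recr /= lerDl mulr_ge0 ?inv_odd_nat_ge0 ?tpart_ge0.
by exists C => _ [n _ <-].
Qed.

(** Partial sums of the Dirichlet beta series at i. *)
Definition altsum {R : realType} (i M : nat) : R :=
  \sum_(j < M) (-1) ^+ j * (odd_nat j ^+ i)^-1.

Definition altharm {R : realType} (p q M : nat) : R :=
  \sum_(j < M) (-1) ^+ j * (oddharm q j / odd_nat j ^+ p).

Lemma tpart_nseq2_cvg (R : realType) a : exists t : R,
  tpart (nseq a 2%N) n @[n --> \oo] --> t /\
  pflim R * altsum (2 * a + 1) M @[M --> \oo] --> t.
Proof.
have [t cvt] : exists t : R, tpart (nseq a 2%N) n @[n --> \oo] --> t.
  apply: (@cvg_tpart _ _ 2) => n; rewrite tpart_nseq2 /pfsum.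
  rewrite -(big_mkord xpredT (fun j => pfweight n j * (odd_nat j ^+ (2 * a + 1))^-1)).
  (* The tail from M = 0 is the whole sum. *)
  have := @pfsum_inv_tail R (2 * a) 0 n; rewrite addn1 divr1.
  by apply: le_trans; exact: ler_norm.
exists t; split=> //; apply: (@squeeze_invS _ _ _ 2) => M.
apply: (@pfsum_truncation _ (fun j => (odd_nat j ^+ (2 * a + 1))^-1)).
  by rewrite -(_ : tpart (nseq a 2%N) = (pfsum ^~ _))//; apply/funext => n; exact: tpart_nseq2.
by move=> n; rewrite addn1; exact: pfsum_inv_tail.
Qed.

Lemma tpart_nseq232_cvg (R : realType) a b : exists t : R,
  tpart (nseq a 2%N ++ 3%N :: nseq b 2%N) n @[n --> \oo] --> t /\
  pflim R * altharm (2 * a + 2) (2 * b + 2) M @[M --> \oo] --> t.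
Proof.
have tailE := @pfsum_oddharm_tail R (2 * a) (2 * b).
have [t cvt] : exists t : R,
    tpart (nseq a 2%N ++ 3%N :: nseq b 2%N) n @[n --> \oo] --> t.
  apply: (@cvg_tpart _ _ 20) => n; rewrite tpart_nseq232 /pfsum.
  rewrite -(big_mkord xpredT (fun j => pfweight n j *
    (oddharm (2 * b + 2) j / odd_nat j ^+ (2 * a + 2)))).
  have := tailE 0%N n; rewrite !addn2 divr1.
  by apply: le_trans; exact: ler_norm.
exists t; split=> //; apply: (@squeeze_invS _ _ _ 20) => M.
apply: (@pfsum_truncation _ (fun j => oddharm (2 * b + 2) j / odd_nat j ^+ (2 * a + 2))).
  rewrite -(_ : tpart (nseq a 2%N ++ 3%N :: nseq b 2%N) = (pfsum ^~ _))//.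
  by apply/funext => n; exact: tpart_nseq232.
by move=> n; rewrite !addn2; exact: tailE.
Qed.

(** * Zeta values at integers as limits of partial sums *)

Definition zetapart {R : realType} (s n : nat) : R :=
  \sum_(i < n) (i.+1%:R ^+ s)^-1.

Lemma zetapart_cvg (R : realType) s : exists2 z : R,
  zetapart s.+2 n @[n --> \oo] --> z & zeta (s.+2%:R : R) = z%:E.
Proof.
have [z cvz] : exists z : R, zetapart s.+2 n @[n --> \oo] --> z.
  exists (limn (@zetapart R s.+2)); apply: nondecreasing_is_cvgn.
    apply/nondecreasing_seqP => n.
    by rewrite /zetapart [leRHS]big_ord_recr /= lerDl invr_ge0 exprn_ge0.
  exists 3 => _ [n _ <-].
  suff : zetapart s.+2 n <= 3 - 2 / n.+1%:R :> R.
    by move/le_trans; apply; rewrite gerBl divr_ge0.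
  elim: n => [|n IH]; first by rewrite /zetapart big_ord0; lra.
  rewrite /zetapart big_ord_recr /= -/(zetapart _ _).
  have : (n.+1%:R ^+ s.+2)^-1 <= 2 / n.+1%:R - 2 / n.+2%:R :> R.
    apply: le_trans (@ge1_expr_inv_le _ _ 2 _ _ _) _ => //; first by rewrite ler1n.
    rewrite -(natr1 n.+1) -(natr1 n); have : 0 <= n%:R :> R by [].
    move: (n%:R) => x x0; rewrite -subr_ge0.
    have -> : 2 / (x + 1) - 2 / (x + 1 + 1) - ((x + 1) ^+ 2)^-1 =
        x / ((x + 1) ^+ 2 * (x + 1 + 1)).
      by field; apply/andP; split; apply/eqP; lra.
    by rewrite divr_ge0// mulr_ge0 ?exprn_ge0//; lra.
  by move=> h; rewrite (le_trans (lerD IH h))// addrA subrK.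
exists z => //; rewrite /zeta; apply/cvg_lim => //.
rewrite (_ : (fun n => _) = (fun n => (zetapart s.+2 n)%:E)).
  by apply: cvg_EFin; [exact: nearW|exact: cvz].
apply/funext => n; rewrite sumEFin big_mkord; congr EFin.
by apply: eq_bigr => i _; rewrite /riemannR powR_mulrn.
Qed.

(** * Evaluation of the alternating double series *)

(* With X = 1/x, Y = 1/y and E = 1/(x+y), these are the partial fractions
   of 1/(x^(p+1) y^(q+1)) for a fixed value of x + y. *)
Lemma partial_fractions (R : comNzRingType) (X Y E : R) (p q : nat) :
  X * Y = E * (X + Y) ->
  X ^+ p.+1 * Y ^+ q.+1 =
  \sum_(t < (p + q).+1) E ^+ t.+1 *
     ('C(t, q)%:R * X ^+ ((p + q).+1 - t) + 'C(t, p)%:R * Y ^+ ((p + q).+1 - t)).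
Proof.
pose F (X Y : R) p q := \sum_(t < (p + q).+1) E ^+ t.+1 *
     ('C(t, q)%:R * X ^+ ((p + q).+1 - t) + 'C(t, p)%:R * Y ^+ ((p + q).+1 - t)).
(* The case p = 0; exchanging the variables by [Fsym] also gives q = 0. *)
have base A B r : A * B = E * (A + B) -> A ^+ 1 * B ^+ r.+1 = F A B 0 r.
  move=> AB; elim: r => [|r IH].
    by rewrite /F big_ord1 !expr1 AB bin0 !mul1r.
  have -> : A ^+ 1 * B ^+ r.+2 = E * (A ^+ 1 * B ^+ r.+1) + E * B ^+ r.+2.
    rewrite (exprS B r.+1); transitivity (A * B * B ^+ r.+1); first by ring.
    by rewrite AB; ring.
  rewrite IH /F [in RHS]big_ord_recl /= mul0r add0r bin0 mul1r expr1.
  rewrite add0n subn0 addrC; congr (_ + _); rewrite mulr_sumr; apply: eq_bigr => t _.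
  rewrite /bump /= add1n subSS binS bin0 mulrA -exprS.
  by rewrite [in RHS]bin_small ?add0n ?bin0// ltnS; case: t.
have Fsym A B r s : F A B r s = F B A s r.
  by rewrite /F addnC; apply: eq_bigr => t _; rewrite addrC.
move=> XY; rewrite -/(F X Y p q); elim: p q => [|p IHp] q; first exact: base.
elim: q => [|q IHq].
  by rewrite Fsym mulrC; apply: base; rewrite mulrC XY addrC.
(* One factor XY becomes E(X + Y), and the two induction hypotheses combine by Pascal's rule. *)
have -> : X ^+ p.+2 * Y ^+ q.+2 = E * (X ^+ p.+2 * Y ^+ q.+1) + E * (X ^+ p.+1 * Y ^+ q.+2).
  rewrite (exprS X p.+1) (exprS Y q.+1).
  transitivity (X * Y * (X ^+ p.+1 * Y ^+ q.+1)); first by ring.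
  by rewrite XY; ring.
rewrite IHp IHq /F [in RHS]big_ord_recl /= !mul0r addr0 mulr0 add0r.
rewrite !addSn !addnS -mulrDr -big_split mulr_sumr; apply: eq_bigr => t _.
by rewrite /= /bump /= add1n !subSS !binS !natrD (exprS E t.+1); ring.
Qed.

Lemma odd_natD (R : realType) j f : odd_nat j + 2 * f%:R = odd_nat (j + f) :> R.
Proof. by rewrite !odd_natE natrD; ring. Qed.

Lemma odd_natB (R : realType) j f : (f <= j)%N ->
  odd_nat j - 2 * f%:R = odd_nat (j - f) :> R.
Proof. by move=> fj; rewrite -{1}(subnK fj) -odd_natD addrK. Qed.

Lemma odd_natBN (R : realType) j f : (j < f)%N ->
  odd_nat j - 2 * f%:R = - odd_nat (f - j.+1) :> R.
Proof.
by move=> jf; rewrite -{1}(subnK jf) !odd_natE natrD -(natr1 j); ring.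
Qed.

Lemma odd_natB_neq0 (R : realType) j f : odd_nat j - 2 * f%:R != 0 :> R.
Proof.
have [fj|jf] := leqP f j; first by rewrite odd_natB// odd_nat_neq0.
by rewrite odd_natBN// oppr_eq0 odd_nat_neq0.
Qed.

(** Shifting k by 2f multiplies chi(k) by (-1)^f. Each of the two shifted sums then contains
    [altsum i f], with the same sign, and these cancel. *)
Lemma altsum_shift (R : realType) i f d :
  \sum_(j < f + d) (-1) ^+ j * ((2 * f%:R - odd_nat j) ^- i - (odd_nat j + 2 * f%:R) ^- i) =
  (-1) ^+ f * ((-1) ^+ i * altsum i d - altsum i (f + d + f)) :> R.
Proof.
transitivity (\sum_(j < f + d) (-1) ^+ j * (2 * f%:R - odd_nat j) ^- i
   - \sum_(j < f + d) (-1) ^+ j * (odd_nat j + 2 * f%:R) ^- i : R).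
  by rewrite -sumrB; apply: eq_bigr => j _; rewrite mulrBr.
have -> : \sum_(j < f + d) (-1) ^+ j * (odd_nat j + 2 * f%:R) ^- i =
    (-1) ^+ f * (altsum i (f + d + f) - altsum i f) :> R.
  rewrite /altsum [in RHS]addnC [X in _ * (X - _)]big_split_ord /= addrAC subrr add0r mulr_sumr.
  apply: eq_bigr => j _; rewrite odd_natD [in RHS]exprD -[in RHS]mulrA signrMK.
  by rewrite (addnC (nat_of_ord j)).
have -> : \sum_(j < f + d) (-1) ^+ j * (2 * f%:R - odd_nat j) ^- i =
    (-1) ^+ f * ((-1) ^+ i * altsum i d - altsum i f) :> R.
  rewrite big_split_ord /= addrC mulrBr; congr (_ + _).
    rewrite /altsum !mulr_sumr; apply: eq_bigr => j _.
    rewrite -[2 * _ - _]opprB odd_natB ?leq_addr// addKn [(- odd_nat _) ^+ _]exprNn.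
    rewrite invfM invr_sign exprD.
    by ring.
  (* For j < f, the number 2f - k is again a positive odd number; it runs through 1, ..., 2f-1 in
     reverse order. *)
  rewrite (reindex_inj rev_ord_inj) /= /altsum mulr_sumr -sumrN; apply: eq_bigr => j _.
  have jf := ltn_ord j.
  rewrite -[2 * _ - _]opprB odd_natBN; last by lia.
  rewrite opprK (_ : f - (f - j.+1).+1 = j)%N; last by lia.
  have -> : (-1) ^+ f = (-1) ^+ (f - j.+1) * (-1) ^+ j.+1 :> R.
    by rewrite -exprD subnK.
  by rewrite exprS mulN1r mulrN mulNr opprK -mulrA signrMK.
by rewrite -mulrBr; congr (_ * _); ring.
Qed.

(** Uses [partial_fractions] for the pairs (k, 2f - k) and (-k, 2f + k), both of sum 2f. The
    exponents p+1 and q+1 are even, so the signs disappear; [altsum_shift] then sums over j. *)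
Lemma altharm_partial_fractions (R : realType) (p q f d : nat) :
  odd p -> odd q -> (0 < f)%N ->
  \sum_(j < f + d) (-1) ^+ j * (odd_nat j ^- p.+1 *
     ((odd_nat j - 2 * f%:R) ^- q.+1 - (odd_nat j + 2 * f%:R) ^- q.+1)) =
  \sum_(t < (p + q).+1) (2 * f%:R) ^- t.+1 *
    ('C(t, q)%:R * (1 - (-1) ^+ ((p + q).+1 - t)) * altsum ((p + q).+1 - t) (f + d) +
     'C(t, p)%:R * (-1) ^+ f *
      ((-1) ^+ ((p + q).+1 - t) * altsum ((p + q).+1 - t) d
       - altsum ((p + q).+1 - t) (f + d + f))) :> R.
Proof.
move=> op oq f0.
have F0 : 2 * f%:R != 0 :> R by rewrite mulf_neq0// pnatr_eq0// -lt0n.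
transitivity (\sum_(j < f + d) (-1) ^+ j * \sum_(t < (p + q).+1)
   (2 * f%:R) ^- t.+1 *
    ('C(t, q)%:R * (1 - (-1) ^+ ((p + q).+1 - t)) * odd_nat j ^- ((p + q).+1 - t) +
     'C(t, p)%:R * ((2 * f%:R - odd_nat j) ^- ((p + q).+1 - t) -
       (odd_nat j + 2 * f%:R) ^- ((p + q).+1 - t))) : R).
  apply: eq_bigr => j _; congr (_ * _).
  have o0 := odd_nat_neq0 R j; have oF := odd_natB_neq0 R j f.
  have oD : odd_nat j + 2 * f%:R != 0 :> R by rewrite odd_natD odd_nat_neq0.
  set F := 2 * f%:R in F0 oF oD *; move: (odd_nat j) o0 oF oD => o o0 oF oD.
  have Fo : F - o != 0 by rewrite -opprB oppr_eq0.
  have e1 : o^-1 * (F - o)^-1 = F^-1 * (o^-1 + (F - o)^-1).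
    by field; rewrite F0 o0 Fo.
  have e2 : (- o)^-1 * (o + F)^-1 = F^-1 * ((- o)^-1 + (o + F)^-1).
    by field; rewrite F0 o0 oD.
  have -> : (o - F) ^- q.+1 = (F - o) ^- q.+1.
    by rewrite -opprB exprNn -signr_odd /= oq expr0 mul1r.
  rewrite mulrBr -!exprVn (partial_fractions p q e1).
  have -> : o^-1 ^+ p.+1 = (- o)^-1 ^+ p.+1.
    by rewrite invrN [RHS]exprNn -signr_odd /= op expr0 mul1r.
  rewrite (partial_fractions p q e2) -sumrB; apply: eq_bigr => t _.
  by rewrite -!exprVn invrN [(- o^-1) ^+ _]exprNn; ring.
under eq_bigr do rewrite mulr_sumr.
rewrite exchange_big /=; apply: eq_bigr => t _.
rewrite -[in RHS](mulrA 'C(t, p)%:R) -altsum_shift.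
rewrite /altsum !mulr_sumr -big_split mulr_sumr; apply: eq_bigr => j _ /=.
by ring.
Qed.

(** * Truncation of the inner series in f *)

Definition symdiff {R : realType} (q j m : nat) : R :=
  \sum_(f < m) ((odd_nat j - 2 * f.+1%:R) ^- q - (odd_nat j + 2 * f.+1%:R) ^- q).

Lemma exprN_even (R : pzRingType) (x : R) q : ~~ odd q -> (- x) ^+ q = x ^+ q.
Proof. by move=> /negbTE oq; rewrite exprNn -signr_odd oq mul1r. Qed.

(* The sum runs over the odd l with 0 < |l - k| <= 2m, where k = 2j+1; since q is
   even, l and -l cancel except for -k <= l < k and at the far end of the range. *)
Lemma symdiffE (R : realType) q j d : ~~ odd q ->
  symdiff q j (j + d) = oddharm q j - \sum_(d <= i < (2 * j + d).+1) odd_nat i ^- q :> R.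
Proof.
move=> oq; elim: d => [|d IH].
  rewrite addn0 /symdiff /oddharm sumrB.
  rewrite (_ : \sum_(i < j) (odd_nat j - 2 * i.+1%:R) ^- q =
    \sum_(i < j) odd_nat i ^- q); last first.
    rewrite (reindex_inj rev_ord_inj) /=; apply: eq_bigr => i _.
    have ij := ltn_ord i; rewrite odd_natB; last by lia.
    by congr (odd_nat _ ^- _); lia.
  rewrite addn0 big_mkord (_ : (2 * j).+1 = j + j.+1)%N; last by lia.
  rewrite big_split_ord /= big_ord_recl /= addn0.
  rewrite (_ : \sum_(i < j) (odd_nat j + 2 * i.+1%:R) ^- q =
    \sum_(i < j) odd_nat (j + bump 0 i) ^- q); first by ring.
  by apply: eq_bigr => i _; rewrite odd_natD.
rewrite addnS /symdiff big_ord_recr /= -/(symdiff _ _ _) IH.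
rewrite odd_natBN; last by lia.
rewrite odd_natD exprN_even// (_ : (j + d).+1 - j.+1 = d)%N; last by lia.
rewrite (_ : j + (j + d).+1 = (2 * j + d).+1)%N; last by lia.
rewrite addnS [\sum_(d.+1 <= i < _) _]big_nat_recr /=; last by lia.
rewrite [\sum_(d <= i < _) _]big_ltn; last by lia.
by ring.
Qed.

Lemma symdiff_le (R : realType) q j m n : ~~ odd q -> (m <= n)%N ->
  symdiff q j m <= symdiff q j n :> R.
Proof.
move=> oq; move: m n; apply/nondecreasing_seqP => m.
rewrite /symdiff big_ord_recr /= lerDl subr_ge0.
set y := 2 * m.+1%:R; have y0 : 0 <= y by rewrite mulr_ge0.
have o0 := odd_nat_gt0 R j.
have := odd_natB_neq0 R j m.+1; rewrite -/y.
move: (odd_nat j) o0 => x x0 xy.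
have p1 : 0 < (x - y) ^+ q by rewrite exprn_even_gt0// xy orbT.
have p2 : 0 < (x + y) ^+ q by rewrite exprn_gt0// ltr_wpDr.
rewrite lef_pV2 ?posrE// -[(x - y) ^+ q]ger0_norm ?(ltW p1)//.
by rewrite normrX lerXn2r ?nnegrE ?addr_ge0 ?(ltW x0)// ler_norml; lra.
Qed.

(** For j < M, [symdiffE] leaves 2j+1 terms, each at most (2M+1)^(-2). For larger j the crude bound
    5 is enough, since the factor k^(-p) is then small. *)
Lemma symdiff_itv (R : realType) q j M : ~~ odd q ->
  symdiff q.+2 j (2 * M) <= oddharm q.+2 j :> R /\
  oddharm q.+2 j - symdiff q.+2 j (2 * M) <=
    (if (j < M)%N then (M.+1%:R)^-1 else 5) :> R.
Proof.
move=> oq; have oq2 : ~~ odd q.+2 by rewrite /= negbK.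
split.
  apply: le_trans (_ : symdiff q.+2 j (j + 2 * M) <= _).
    by apply: symdiff_le => //; rewrite leq_addl.
  by rewrite symdiffE// gerBl; apply: sumr_ge0 => i _; exact: inv_odd_nat_ge0.
case: ifPn => jM.
  rewrite (_ : 2 * M = j + (2 * M - j))%N; last by lia.
  rewrite symdiffE// subKr.
  apply: le_trans (_ : \sum_(2 * M - j <= i < (2 * j + (2 * M - j)).+1) odd_nat M ^- 2 <= _).
    apply: ler_sum_nat => i /andP[h _].
    apply: le_trans (ge1_expr_inv_le (odd_nat_ge1 _ _) _) (inv_odd_nat_le _ 2 _) => //.
    by lia.
  rewrite sumr_const_nat (_ : _ - _ = 2 * j + 1)%N; last by lia.
  rewrite -[leLHS]mulr_natl -/(odd_nat j) expr2 invfM mulrA -[leRHS]mul1r.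
  rewrite ler_pM ?divr_ge0 ?invr_ge0 ?(ltW (odd_nat_gt0 _ _))//.
    by rewrite ler_pdivrMr ?odd_nat_gt0// mul1r odd_nat_le// ltnW.
  by rewrite lef_pV2 ?posrE ?odd_nat_gt0// /odd_nat ler_nat; lia.
have /andP[_ h5] := oddharm_itv R q j.
have : 0 <= symdiff q.+2 j (2 * M) :> R.
  by rewrite -(_ : symdiff q.+2 j 0 = 0) ?symdiff_le// /symdiff big_ord0.
by lra.
Qed.

(** The bound is uniform in d, so the sum over j can be completed before the cutoff 2M on f is
    removed. *)
Lemma altharm_approx (R : realType) p q M d : ~~ odd q ->
  `|altharm p.+2 q.+2 (2 * M + d) - \sum_(j < 2 * M + d) (-1) ^+ j *
     (odd_nat j ^- p.+2 * symdiff q.+2 j (2 * M))| <= 12 / M.+1%:R :> R.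
Proof.
move=> oq; rewrite /altharm -sumrB.
apply: le_trans (ler_norm_sum _ _ _) _.
apply: le_trans (_ : \sum_(j < 2 * M + d) (odd_nat j ^- 2 *
  (if (j < M)%N then (M.+1%:R)^-1 else 5)) <= _).
  apply: ler_sum => j _.
  rewrite -mulrBr [oddharm _ _ / _]mulrC -mulrBr !normrM normrX normrN1 expr1n mul1r.
  have [h1 h2] := symdiff_itv R j M oq.
  rewrite ler_pM// ger0_norm ?subr_ge0 ?inv_odd_nat_ge0//.
  exact: (ge1_expr_inv_le (odd_nat_ge1 _ _)).
rewrite -(big_mkord xpredT (fun j => odd_nat j ^- 2 * (if (j < M)%N then (M.+1%:R)^-1 else 5))).
rewrite (big_cat_nat (n := M))//=; last by lia.
(* The range is split at j = M: total mass 2 with error 1/(M+1), then tail mass 2/(M+1) with error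
   5. *)
have -> : 12 / M.+1%:R = 2 * (M.+1%:R)^-1 + 2 / M.+1%:R * 5 :> R by ring.
apply: lerD.
  apply: le_trans (_ : \sum_(0 <= j < M) odd_nat j ^- 2 * (M.+1%:R)^-1 <= _).
    by apply: ler_sum_nat => j /andP[_ ->].
  rewrite -mulr_suml ler_wpM2r ?invr_ge0//.
  by apply: le_trans (sum_inv_odd_sqr _ _ _) _; rewrite divr1.
apply: le_trans (_ : \sum_(M <= j < 2 * M + d) odd_nat j ^- 2 * 5 <= _).
  by apply: ler_sum_nat => j /andP[Mj _]; rewrite ltnNge Mj.
by rewrite -mulr_suml ler_wpM2r ?sum_inv_odd_sqr.
Qed.

(** * Removal of the two cutoffs *)

Lemma sum_even (V : nmodType) (F : nat -> V) n :
  (forall t, odd t -> F t = 0) -> \sum_(t < (2 * n).+1) F t = \sum_(r < n.+1) F (2 * r)%N.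
Proof.
move=> F0; elim: n => [|n IH]; first by rewrite !big_ord1.
rewrite (_ : (2 * n.+1).+1 = (2 * n).+3)%N; last by lia.
rewrite big_ord_recr big_ord_recr IH [in RHS]big_ord_recr /= F0 ?addr0; last first.
  by rewrite /= mul2n odd_double.
by congr (_ + F _); lia.
Qed.

(** The even denominators carry the minus sign, so they are subtracted twice; their sum is 2^(-s)
    times the partial sum of half the length. *)
Lemma alternating_zetapart (R : realType) s M :
  \sum_(f < 2 * M) (-1) ^+ f * (f.+1%:R ^+ s)^-1 =
  zetapart s (2 * M) - 2 / 2 ^+ s * zetapart s M :> R.
Proof.
rewrite /zetapart; elim: M => [|M IH]; first by rewrite !big_ord0; ring.
rewrite (_ : 2 * M.+1 = (2 * M).+2)%N; last by lia.
rewrite big_ord_recr big_ord_recr IH /= [\sum_(i < (2 * M).+2) _]big_ord_recr.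
rewrite [\sum_(i < (2 * M).+1) _]big_ord_recr [\sum_(i < M.+1) _]big_ord_recr /=.
rewrite exprS exprM sqrrN !expr1n (_ : (2 * M).+2 = 2 * M.+1)%N; last by lia.
by rewrite natrM exprMn invfM; ring.
Qed.

Lemma altsum_dist (R : realType) i k l d : (l <= k)%N ->
  `|altsum i.+1 (l + d) - altsum i.+1 (k + d)| <= 1 / d.+1%:R :> R.
Proof.
move=> lk; rewrite distrC /altsum.
rewrite -!(big_mkord xpredT (fun j => (-1) ^+ j * (odd_nat j ^+ i.+1)^-1)).
rewrite (big_cat_nat (n := (l + d)%N) (p := (k + d)%N))//= ?leq_add2r//.
rewrite addrAC subrr add0r.
apply: le_trans (@alternating_sum_le _ (fun j => (odd_nat j ^+ i.+1)^-1) _ _ _ _) _.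
- by move=> j; exact: inv_odd_nat_ge0.
- by move=> j; exact: inv_odd_nat_le.
apply: le_trans (@ge1_expr_inv_le _ _ 1 _ (odd_nat_ge1 _ _) _) _ => //.
by rewrite expr1 div1r lef_pV2 ?posrE ?odd_nat_gt0// /odd_nat ler_nat; lia.
Qed.

Lemma cvg_shiftnl (R : realType) (u : nat -> R) (l : R) k :
  u n @[n --> \oo] --> l -> u (k + n)%N @[n --> \oo] --> l.
Proof. by move=> ul; apply: (cvg_comp _ _ (cvg_addnl k) ul). Qed.

(** For odd t the exponent is even: the first term is zero and the two shifted sums cancel in the
    limit. For even t the exponent is odd, and each part contributes twice the same beta value. *)
Lemma cvg_altsum_coef (R : realType) (T : nat -> R) (x y : R) n t k l m :
  (forall a, pflim R * altsum (2 * a + 1) M @[M --> \oo] --> T a) ->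
  (t <= 2 * n)%N -> (l <= m)%N ->
  pflim R * (x * (1 - (-1) ^+ ((2 * n).+1 - t)) * altsum ((2 * n).+1 - t) (k + d) +
    y * ((-1) ^+ ((2 * n).+1 - t) * altsum ((2 * n).+1 - t) (l + d)
         - altsum ((2 * n).+1 - t) (m + d))) @[d --> \oo] -->
  (if odd t then 0 else 2 * (x - y) * T (n - t./2)%N).
Proof.
move=> cvT tn lm; have [i it] : exists i, ((2 * n).+1 - t = i.+1)%N.
  by exists (2 * n - t)%N; rewrite subSn.
have oi : odd ((2 * n).+1 - t) = ~~ odd t.
  by rewrite oddB ?(leqW tn)//= oddM.
rewrite -signr_odd oi; case: ifPn => ot; rewrite /= ?expr0 ?expr1.
  have c0 : (altsum i.+1 (l + d) - altsum i.+1 (m + d)) @[d --> \oo] --> (0 : R).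
    apply: (@squeeze_invS _ _ _ 1) => d; rewrite sub0r normrN; exact: altsum_dist.
  rewrite it (_ : (fun d => _) = (fun d => pflim R * y *
     (altsum i.+1 (l + d) - altsum i.+1 (m + d)))).
    by rewrite -[X in _ --> X](mulr0 (pflim R * y)); exact: cvgMr.
  by apply/funext => d; ring.
have tE : t = (2 * t./2)%N by rewrite mul2n even_halfK.
rewrite {ot oi it}(_ : (2 * n).+1 - t = 2 * (n - t./2) + 1)%N; last by lia.
set s := (2 * (n - t./2) + 1)%N; set L := T _.
have cv h : pflim R * altsum s (h + d) @[d --> \oo] --> L.
  exact: (cvg_shiftnl h (cvT (n - t./2)%N)).
rewrite (_ : (fun d => _) = (fun d => 2 * x * (pflim R * altsum s (k + d))
    - y * (pflim R * altsum s (l + d)) - y * (pflim R * altsum s (m + d)))).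
  rewrite (_ : 2 * (x - y) * L = 2 * x * L - y * L - y * L); last by ring.
  by apply: cvgB; [apply: cvgB|]; apply: cvgMr; exact: cv.
by apply/funext => d; ring.
Qed.

Lemma cvg_altharm (R : realType) (a b : nat) (T Z : nat -> R) (t : R) :
  (forall c, pflim R * altsum (2 * c + 1) M @[M --> \oo] --> T c) ->
  (forall r, (0 < r)%N -> zetapart (2 * r + 1) M @[M --> \oo] --> Z r) ->
  pflim R * altharm (2 * a + 2) (2 * b + 2) M @[M --> \oo] --> t ->
  t = \sum_(1 <= r < (a + b + 1).+1)
     (2 ^- (2 * r) * ((1 - 2 ^- (2 * r)) * 'C(2 * r, 2 * a + 1)%:R
                       + 'C(2 * r, 2 * b + 1)%:R)) * T (a + b + 1 - r)%N * Z r.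
Proof.
move=> cvT cvZ cvt.
set n := (a + b + 1)%N.
pose c (f t : nat) : R := 2 * ('C(t, 2 * b + 1)%:R - 'C(t, 2 * a + 1)%:R * (-1) ^+ f).
(* [W M] is the sum over the first 2M values of f once d, hence the range of j, has gone to
   infinity. *)
pose W M : R := \sum_(f < 2 * M) \sum_(t < (2 * n).+1) (2 * f.+1%:R) ^- t.+1 *
   (if odd t then 0 else c f.+1 t * T (n - t./2)%N).
have nE : (2 * a + 1 + (2 * b + 1)).+1 = (2 * n).+1 by rewrite /n; lia.
have odd21 e : odd (2 * e + 1) by rewrite addn1 /= mul2n odd_double.
have distW M : `|t - W M| <= 24 / M.+1%:R.
  apply: (@cvgn_le _ (fun d => `|pflim R * altharm (2 * a + 2) (2 * b + 2) (2 * M + d) -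
    pflim R * \sum_(j < 2 * M + d) (-1) ^+ j *
     (odd_nat j ^- (2 * a + 2) * symdiff (2 * b + 2) j (2 * M))|)); last first.
    apply: nearW => d; rewrite -mulrBr normrM.
    rewrite (_ : 24 / M.+1%:R = 2 * (12 / M.+1%:R)); last by ring.
    rewrite ler_pM//.
      rewrite ger0_norm; last by rewrite (le_trans ler01) ?pflim_ge1.
      by apply: (cvgn_le (@cvg_pfconst R)); apply: nearW => i; exact: pfconst_le2.
    by rewrite !addn2 altharm_approx// mul2n odd_double.
  apply: cvg_norm; apply: cvgB; first exact: cvg_shiftnl cvt.
  rewrite (_ : (fun d => _) = (fun d => \sum_(f < 2 * M) \sum_(t < (2 * n).+1)
    (2 * f.+1%:R) ^- t.+1 * (pflim R *
     ('C(t, 2 * b + 1)%:R * (1 - (-1) ^+ ((2 * n).+1 - t)) * altsum ((2 * n).+1 - t) (2 * M + d) +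
     'C(t, 2 * a + 1)%:R * (-1) ^+ f.+1 *
      ((-1) ^+ ((2 * n).+1 - t) * altsum ((2 * n).+1 - t) (2 * M - f.+1 + d)
       - altsum ((2 * n).+1 - t) (2 * M + f.+1 + d)))))); last first.
    apply/funext => d; rewrite mulr_sumr.
    transitivity (pflim R * \sum_(f < 2 * M) \sum_(j < 2 * M + d) (-1) ^+ j *
       (odd_nat j ^- (2 * a + 2) * ((odd_nat j - 2 * f.+1%:R) ^- (2 * b + 2)
         - (odd_nat j + 2 * f.+1%:R) ^- (2 * b + 2)))).
      rewrite exchange_big mulr_sumr; apply: eq_bigr => j _.
      by rewrite /symdiff !mulr_sumr.
    rewrite mulr_sumr; apply: eq_bigr => f _.
    have fM := ltn_ord f.
    (* Since f+1 <= 2M, the range of j has the length required by [altharm_partial_fractions]. *)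
    have dE : (2 * M + d = f.+1 + (2 * M - f.+1 + d))%N by lia.
    rewrite [in LHS]dE (_ : 2 * a + 2 = (2 * a + 1).+1)%N; last by lia.
    rewrite (_ : 2 * b + 2 = (2 * b + 1).+1)%N; last by lia.
    rewrite altharm_partial_fractions ?odd21// -dE nE mulr_sumr.
    apply: eq_bigr => s _; rewrite (_ : 2 * M + d + f.+1 = 2 * M + f.+1 + d)%N; last by lia.
    by ring.
  apply: cvg_big => [|f _]; first exact: add_continuous.
  apply: cvg_big => [|s _]; first exact: add_continuous.
  apply: cvgMr; rewrite /c; apply: cvg_altsum_coef => //.
  - by rewrite -ltnS.
  - by rewrite leq_subLR; lia.
have cvW : W M @[M --> \oo] --> t by exact: squeeze_invS distW.
set rhs := RHS; suff : W M @[M --> \oo] --> rhs by exact: cvg_unique cvW.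
rewrite (_ : W = fun M => \sum_(1 <= r < n.+1)
     (2 ^- (2 * r) * ('C(2 * r, 2 * b + 1)%:R * zetapart (2 * r + 1) (2 * M) +
        'C(2 * r, 2 * a + 1)%:R * (zetapart (2 * r + 1) (2 * M) -
          2 ^- (2 * r) * zetapart (2 * r + 1) M)) * T (n - r)%N)); last first.
  apply/funext => M; rewrite /W exchange_big /=.
  rewrite (sum_even (F := fun s => \sum_(f < 2 * M) (2 * f.+1%:R) ^- s.+1 *
     (if odd s then 0 else c f.+1 s * T (n - s./2)%N))); last first.
    by move=> s ->; apply: big1 => f _; rewrite mulr0.
  rewrite -(big_mkord xpredT (fun r => \sum_(f < 2 * M) (2 * f.+1%:R) ^- (2 * r).+1 *
     (if odd (2 * r) then 0 else c f.+1 (2 * r)%N * T (n - (2 * r)./2)%N))).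
  (* The term r = 0, which would carry the divergent harmonic series, vanishes because its binomials
     C(0, 2b+1) and C(0, 2a+1) do. *)
  rewrite big_ltn// [X in X + _]big1 ?add0r; last first.
    by move=> f _; rewrite /c !bin_small ?addn1//= mul0r subr0 mulr0 mul0r mulr0.
  apply: eq_bigr => r _; rewrite (mul2n r) odd_double doubleK -(mul2n r).
  (* The minus sign in [c] turns (-1)^(f+1) into (-1)^f, and its factor 2 is moved out in front. *)
  transitivity (2 / 2 ^+ (2 * r).+1 * ('C(2 * r, 2 * b + 1)%:R * zetapart (2 * r).+1 (2 * M) +
     'C(2 * r, 2 * a + 1)%:R * \sum_(f < 2 * M) (-1) ^+ f * (f.+1%:R ^+ (2 * r).+1)^-1)
     * T (n - r)%N).
    rewrite /zetapart !mulr_sumr -big_split mulr_sumr mulr_suml; apply: eq_bigr => f _ /=.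
    by rewrite /c exprMn invfM (exprS (-1) f); ring.
  rewrite alternating_zetapart (addn1 (2 * r)).
  have -> : 2 / 2 ^+ (2 * r).+1 = 2 ^- (2 * r) :> R.
    by rewrite exprS invfM mulrA divff// mul1r.
  by [].
rewrite /rhs big_nat; under eq_fun do rewrite big_nat.
apply: cvg_big => [|r /andP[r0 _]]; first exact: add_continuous.
have z2 : zetapart (2 * r + 1) (2 * M) @[M --> \oo] --> Z r.
  exact: (cvg_comp _ _ (@cvg_mulnl 2 isT) (cvZ _ r0)).
rewrite (_ : _ * T _ * Z r = 2 ^- (2 * r) * ('C(2 * r, 2 * b + 1)%:R * Z r +
  'C(2 * r, 2 * a + 1)%:R * (Z r - 2 ^- (2 * r) * Z r)) * T (n - r)%N); last by ring.
apply: cvgMl; apply: cvgMr; apply: cvgD; first exact: cvgMr.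
by apply: cvgMr; apply: cvgB => //; apply: cvgMr; exact: cvZ.
Qed.

Theorem theorem4p1 (R : realType) (a b : nat) :
  tstar R (nseq a 2%N ++ 3%N :: nseq b 2%N) =
  (\sum_(1 <= r < (a + b + 1).+1)
     ((2 ^- (2 * r) * ((1 - 2 ^- (2 * r)) * 'C(2 * r, 2 * a + 1)%:R
                       + 'C(2 * r, 2 * b + 1)%:R))%R)%:E
     * tstar R (nseq (a + b + 1 - r) 2%N)
     * zeta ((2 * r + 1)%:R : R))%E.
Proof.
(* [T c] is the limit both of the truncations of t*({2}^c) and of [pflim] times the beta sums; the
   factor [pflim] thus enters both sides of the identity once. *)
have [T cvT] := choice (@tpart_nseq2_cvg R).
have /choice[Z cvZ] r : exists z : R, (0 < r)%N ->
    zetapart (2 * r + 1) n @[n --> \oo] --> z /\ zeta ((2 * r + 1)%:R : R) = z%:E.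
  (* The value 0 at r = 0 is a placeholder, zeta(1) being infinite; the sum starts at r = 1. *)
  case: r => [|r]; first by exists 0.
  have [z cvz zE] := zetapart_cvg R (2 * r + 1).
  by exists z => _; rewrite (_ : 2 * r.+1 + 1 = (2 * r + 1).+2)%N //; lia.
have [t [cvt /cvg_altharm tE]] := tpart_nseq232_cvg R a b.
rewrite (tstar_lim cvt) (tE T Z); last 2 first.
- by move=> c; have [] := cvT c.
- by move=> r /cvZ[].
rewrite -sumEFin !big_nat; apply: eq_bigr => r /andP[/cvZ[_ ->] _].
by have [/tstar_lim -> _] := cvT (a + b + 1 - r)%N; rewrite !EFinM.
Qed.
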